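(* Let $X$ be an NPC space, let $G$ be a totally disconnected, locally compact group acting properly and continuously by isometries on $X$ and let $g \in G$ be hyperbolic, with attracting and repelling points $\xi_+$ and $\xi_-$ respectively. Let $U \le G$ be an open subgroup. Then the product $U_{\xi_+}U_{\xi_-}$ is a neighbourhood of the identity in $G$.
   Context: An NPC space is a geodesic metric space $X$ that is either (a) complete and CAT(0), or (b) proper (closed balls are compact) and $\delta$-hyperbolic for some $\delta \ge 0$ (every geodesic triangle is $\delta$-thin: each point on a side lies within distance $\delta$ of a point on another side). The boundary $\partial X$ is the set of equivalence classes of geodesic rays, where $\gamma_1\sim\gamma_2$ if $d(\gamma_1(t),\gamma_2(t))$ is bounded over $t\ge 0$; isometries act on $\partial X$, and for a subgroup $U\le G$, $U_\xi$ denotes the stabilizer of $\xi\in\partial X$ in $U$. Convergence of sequences in $X$ to boundary points is in the usual sense (cone topology for CAT(0) spaces, Gromov boundary for proper $\delta$-hyperbolic spaces). An isometry $g$ is hyperbolic if: in case (a), it has an axis, i.e. there are a geodesic line $\gamma:\mathbb{R}\to X$ and $k>0$ with $g\gamma(t)=\gamma(t+k)$ for all $t$; in case (b), $n\mapsto g^nx$ is a quasi-isometric embedding of $\mathbb{Z}$ into $X$ for some (equivalently any) $x$. A point $\xi\in\partial X$ is the attracting point $\xi_+(g)$ of $g$ if $g^nx\to\xi$ as $n\to+\infty$ for all $x\in X$; the repelling point is $\xi_-(g):=\xi_+(g^{-1})$. For hyperbolic $g$ both exist and are distinct. An isometric action of $G$ on $X$ is proper if for all $x\in X$, $r>0$ the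 set $\{g\in G: d(gx,x)\le r\}$ has compact closure. *)

(* Defs.v *)
From HB Require Import structures.
From mathcomp Require Import all_boot all_order all_algebra.
From mathcomp Require Import all_classical all_reals all_analysis.

Set Implicit Arguments.
Unset Strict Implicit.
Unset Printing Implicit Defensive.

Import Order.TTheory GRing.Theory Num.Theory.
Import numFieldNormedType.Exports.

Local Open Scope classical_set_scope.
Local Open Scope ring_scope.

(** * Topological groups *)

HB.mixin Record isTopologicalGroup G & Topological G & Group G := {
  mulg_continuous : continuous (fun gh : G * G => (gh.1 * gh.2)%g) ;
  invg_continuous : continuous (fun g : G => g^-1%g) }.

#[short(type="topologicalGroupType")]
HB.structure Definition TopologicalGroup :=
  { G of Topological G & Group G & isTopologicalGroup G }.

Definition expgz (G : groupType) (g : G) (n : int) : G :=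
  match n with Posz m => (g ^+ m)%g | Negz m => (g ^- m.+1)%g end.

(** * Geodesics *)

(* Segments, rays and lines are represented by total functions [R -> X] of
   which only the values on [0, d x y], [0, +oo[ and R respectively matter. *)
Section Geodesics.
Context {R : realType} {X : metricType R}.
Implicit Types (x y z : X) (c : R -> X).

Definition isometric_on (A : set R) c :=
  forall s t, A s -> A t -> mdist (c s) (c t) = `|s - t|.

Definition geodesic_segment x y c :=
  [/\ isometric_on `[0, mdist x y] c, c 0 = x & c (mdist x y) = y].

Definition geodesic_ray c := isometric_on `[0, +oo[ c.

Definition geodesic_line c := isometric_on setT c.

Definition segment_points x y c : set X := c @` `[0, mdist x y].

Definition geodesic_triangle x y z (c1 c2 c3 : R -> X) :=
  [/\ geodesic_segment x y c1, geodesic_segment y z c2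
    & geodesic_segment z x c3].

End Geodesics.

Definition geodesic_space (R : realType) (X : metricType R) :=
  forall x y : X, exists c, geodesic_segment x y c.

(** * CAT(0) spaces *)

(* The canonical norm on [R * R] is the sup norm, hence an explicit distance. *)
Definition plane_dist (R : realType) (p q : R * R) : R :=
  Num.sqrt ((p.1 - q.1) ^+ 2 + (p.2 - q.2) ^+ 2).

Section CAT0.
Context {R : realType} {X : metricType R}.

(* [p'] is the comparison point, on the Euclidean segment [x', y'], of the
   point [p] of the side [c] from [x] to [y]: since
   [plane_dist x' y' = mdist x y], the two equations say that [p'] lies on
   [x', y'] at distance [t] from [x']. *)
Definition comparison_point (x y : X) (c : R -> X) (x' y' : R * R)
    (p : X) (p' : R * R) :=
  exists t, [/\ `[0, mdist x y]%classic t, p = c t,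
    plane_dist x' p' = t & plane_dist p' y' = mdist x y - t].

Definition is_CAT0 :=
  forall (x y z : X) (c1 c2 c3 : R -> X) (x' y' z' : R * R),
    geodesic_triangle x y z c1 c2 c3 ->
    plane_dist x' y' = mdist x y ->
    plane_dist y' z' = mdist y z ->
    plane_dist z' x' = mdist z x ->
    let compares p p' :=
      [\/ comparison_point x y c1 x' y' p p',
          comparison_point y z c2 y' z' p p'
        | comparison_point z x c3 z' x' p p'] in
    forall p q p' q', compares p p' -> compares q q' ->
      mdist p q <= plane_dist p' q'.

(* Completeness as a proposition ([completeType] also requires a point). *)
Definition is_complete :=
  forall F : set_system X, ProperFilter F -> cauchy F -> exists l : X, F --> l.

End CAT0.

(** * Proper hyperbolic spaces *)

Section Hyperbolic.
Context {R : realType} {X : metricType R}.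

(* [closed_ball] is the closure of the open ball, hence the explicit set. *)
Definition is_proper_space :=
  forall (x : X) (r : R), compact [set y | mdist x y <= r].

Definition near_set (delta : R) (A B : set X) :=
  forall p, A p -> exists2 q, B q & mdist p q <= delta.

Definition thin_triangles (delta : R) :=
  forall (x y z : X) (c1 c2 c3 : R -> X),
    geodesic_triangle x y z c1 c2 c3 ->
    let s1 := segment_points x y c1 in
    let s2 := segment_points y z c2 in
    let s3 := segment_points z x c3 in
    [/\ near_set delta s1 (s2 `|` s3),
        near_set delta s2 (s3 `|` s1)
      & near_set delta s3 (s1 `|` s2)].

Definition is_hyperbolic_space := exists2 delta : R, 0 <= delta & thin_triangles delta.

Definition gromov_product (p x y : X) : R :=
  (mdist p x + mdist p y - mdist x y) / 2.

End Hyperbolic.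

(** * NPC spaces *)

(* The notions of hyperbolic isometry and of convergence to the boundary are
   defined separately in the two cases of the definition of an NPC space, so
   they are indexed by the case. *)
Inductive npc_case := CaseCAT0 | CaseHyperbolic.

Definition NPC (k : npc_case) (R : realType) (X : metricType R) :=
  geodesic_space X /\
  match k with
  | CaseCAT0 => @is_complete R X /\ @is_CAT0 R X
  | CaseHyperbolic => @is_proper_space R X /\ @is_hyperbolic_space R X
  end.

(** * The boundary *)

Section Boundary.
Context {R : realType} {X : metricType R}.

Definition asymptotic (c1 c2 : R -> X) :=
  exists C : R, forall t, 0 <= t -> mdist (c1 t) (c2 t) <= C.

Definition ray_class (c : R -> X) : set (R -> X) :=
  [set c' | geodesic_ray c' /\ asymptotic c c'].

End Boundary.

Record boundary (R : realType) (X : metricType R) := Boundary {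
  rays_to : set (R -> X) ;
  rays_toP : exists2 c, geodesic_ray c & rays_to = ray_class c }.

Section Convergence.
Context {R : realType} {X : metricType R}.
Implicit Types (x : nat -> X) (xi : boundary X).

(* Convergence for the cone topology: with [c] a ray to [xi], the basic
   neighbourhoods of [xi] consist of the points [y] with [d (c 0) y > r] for
   which the point at distance [r] from [c 0] on the geodesic from [c 0] to [y]
   is at distance less than [e] from [c r]. *)
Definition cone_cvg x xi :=
  forall c, rays_to xi c -> forall r e : R, 0 < r -> 0 < e ->
    \forall n \near \oo, r < mdist (c 0) (x n) /\
      forall s, geodesic_segment (c 0) (x n) s -> mdist (s r) (c r) < e.

(* Convergence to a point of the Gromov boundary: the Gromov products of the
   sequence with the points of a ray to [xi] tend to infinity. *)
Definition gromov_cvg x xi :=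
  forall c, rays_to xi c -> forall (p : X) (M : R),
    \forall n \near \oo & t \near +oo%R, M <= gromov_product p (x n) (c t).

Definition boundary_cvg (k : npc_case) x xi :=
  match k with
  | CaseCAT0 => cone_cvg x xi
  | CaseHyperbolic => gromov_cvg x xi
  end.

End Convergence.

(** * Isometric actions *)

Record isometric_action (R : realType) (G : groupType) (X : metricType R) :=
  IsometricAction {
    act :> G -> X -> X ;
    act1 : forall x, act 1%g x = x ;
    actM : forall g h x, act (g * h)%g x = act g (act h x) ;
    act_isometry : forall g x y, mdist (act g x) (act g y) = mdist x y }.

Section BoundaryAction.
Context {R : realType} {G : groupType} {X : metricType R}.
Variable a : isometric_action G X.

Lemma act_ray g c : geodesic_ray c -> geodesic_ray (a g \o c).
Proof. by move=> rc s t s0 t0 /=; rewrite act_isometry rc. Qed.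

Lemma act_ray_class g c :
  (fun c' => a g \o c') @` ray_class c = ray_class (a g \o c).
Proof.
apply/seteqP; split=> [_ [c' [rc' [C cc']] <-]|c' [rc' [C cc']]].
  split; first exact: act_ray.
  by exists C => t t0 /=; rewrite act_isometry cc'.
exists (a g^-1%g \o c'); last first.
  by apply/funext => t /=; rewrite -actM mulgV act1.
split; first exact: act_ray.
exists C => t t0 /=.
by rewrite -(act_isometry a g) -actM mulgV act1 cc'.
Qed.

Lemma act_boundaryP g (xi : boundary X) :
  exists2 c, geodesic_ray c &
    (fun c' => a g \o c') @` rays_to xi = ray_class c.
Proof.
have [c rc ->] := rays_toP xi.
by exists (a g \o c); [exact: act_ray|exact: act_ray_class].
Qed.

Definition act_boundary g (xi : boundary X) : boundary X :=
  Boundary (act_boundaryP g xi).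

Definition boundary_stab (U : set G) (xi : boundary X) : set G :=
  [set u | U u /\ act_boundary u xi = xi].

Definition has_axis (g : G) :=
  exists (c : R -> X) (k : R),
    [/\ geodesic_line c, 0 < k & forall t, a g (c t) = c (t + k)].

Definition orbit_quasi_isometric (g : G) :=
  exists (x : X) (L C : R), [/\ 1 <= L, 0 <= C &
    forall m n : int,
      L^-1 * `|m - n|%:~R - C <= mdist (a (expgz g m) x) (a (expgz g n) x)
                              <= L * `|m - n|%:~R + C].

Definition hyperbolic_isometry (k : npc_case) (g : G) :=
  match k with
  | CaseCAT0 => has_axis g
  | CaseHyperbolic => orbit_quasi_isometric g
  end.

Definition attracting_point (k : npc_case) (g : G) (xi : boundary X) :=
  forall x : X, boundary_cvg k (fun n => a (g ^+ n)%g x) xi.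

Definition repelling_point (k : npc_case) (g : G) (xi : boundary X) :=
  attracting_point k g^-1%g xi.

End BoundaryAction.

Definition continuous_action (R : realType) (G : topologicalGroupType)
    (X : metricType R) (a : isometric_action G X) :=
  continuous (fun gx : G * X => a gx.1 gx.2).

Definition proper_action (R : realType) (G : topologicalGroupType)
    (X : metricType R) (a : isometric_action G X) :=
  forall (x : X) (r : R), 0 < r ->
    compact (closure [set g : G | mdist (a g x) x <= r]).

(* Main.v *)
Require Import Defs.
From mathcomp Require Import all_boot all_order all_algebra.
From mathcomp Require Import all_classical all_reals all_analysis.
From mathcomp Require Import ring lra.

(** Write [x ^ h] for the conjugate [h^-1 * x * h]. Two facts combine.

    Geometry ([bounded_displacement_fixes]): if a sequence [x_n] converges to
    the boundary point [xi] and an isometry [u] moves the points [x_n] by a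
    bounded amount, then [u] fixes [xi]. Let [c] be a ray to [xi]. The geodesic
    from [c 0] to [x_n] passes near [c r] for large [n], its image by [u] passes
    near [u (c r)], and these two geodesics, whose endpoints are at bounded
    distance from each other, are at distance bounded independently of [r] at
    time [r]. Hence [c] and [u \o c] are asymptotic. The only geometry needed is
    that two geodesics with a common endpoint stay close
    ([NPC_fellow_travel]); it follows from one comparison triangle in the CAT(0)
    case and from one thin triangle in the hyperbolic case. As
    [d (u g^n x) (g^n x) = d ((u ^ g^n) x) x], every [u] whose conjugates
    [u ^ g^n], [n >= 0], stay in a set of bounded displacement at [x] fixes
    [xi_+]; with [g^-n] for [g^n] it fixes [xi_-].

    Groups ([tidy_above]): for every neighbourhood [N] of [1] in a totally
    disconnected locally compact group, the products [p * u] where all [p ^ g^n]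
    and all [u ^ g^-n], [n >= 0], lie in [N] form a neighbourhood of [1]. By van
    Dantzig's theorem ([van_dantzig]) [N] contains a compact open subgroup [V],
    and by an argument of Willis there is an [m] such that every element of the
    subgroup [W] of the [x] with [x ^ g^i] in [V] for all [i <= m] is a product
    [p * u], where all [p ^ g^n] and all [u ^ g^-n], [n >= 0], lie in [W].

    The theorem follows by taking for [N] the elements of [U] that move a base
    point by at most 1. *)

Set Implicit Arguments.
Unset Strict Implicit.
Unset Printing Implicit Defensive.

Import Order.TTheory GRing.Theory Num.Theory.
Import numFieldNormedType.Exports.

Local Open Scope classical_set_scope.

(** * Compact open neighbourhoods in totally disconnected spaces *)

(** If the intersection of a directed family of closed sets lies, within a
    compact set, in an open set, then so does some member of the family. *)
Lemma compact_bigcap_sub (T : topologicalType) (I : Type) (D : set I)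
    (C : I -> set T) (K O : set T) :
  compact K -> open O -> (forall i, D i -> closed (C i)) -> D !=set0 ->
  (forall i j, D i -> D j -> exists2 k, D k & C k `<=` C i `&` C j) ->
  K `&` \bigcap_(i in D) C i `<=` O -> exists2 i, D i & K `&` C i `<=` O.
Proof.
move=> cK oO clC [i0 Di0] dirC sub; apply: contrapT => nex.
pose F := filter_from D (fun i => (K `&` C i) `\` O).
have FF : Filter F.
  apply: filter_from_filter; first by exists i0.
  move=> i j Di Dj; have [k Dk kij] := dirC i j Di Dj.
  by exists k => // x [[Kx /kij[Cix Cjx]] nOx]; split.
have PF : ProperFilter F.
  apply: filter_from_proper => i Di; apply: contrapT => /nonemptyPn e0.
  apply: nex; exists i => // x KCx; apply: contrapT => nOx.
  by have : set0 x by rewrite -e0.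
have FK : F K by exists i0 => // x [[]].
have [p [Kp]] := cK F PF FK; rewrite clusterE => clp.
have pC i : D i -> C i p /\ ~ O p.
  move=> Di; have /closureI[] : closure (C i `&` ~` O) p.
    by apply: clp; exists i => // x [[_ Cx] nOx].
  rewrite -(closure_id _).1; last exact: clC.
  by rewrite -(closure_id _).1; last exact: open_closedC.
have [_] := pC i0 Di0; apply; apply: sub; split=> // i Di.
by have [] := pC i Di.
Qed.

Lemma hausdorff_compact_separation (T : topologicalType) (A B : set T) :
  hausdorff_space T -> locally_compact [set: T] ->
  compact A -> closed B -> A `&` B = set0 ->
  exists O, [/\ open O, A `<=` O & closure O `&` B = set0].
Proof.
move=> hT lcT cA clB AB0.
have [->|/set0P Bn0] := eqVneq B set0.
  by exists setT; split; [exact: openT|exact: subsetT|rewrite setI0].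
have PB := set_nbhs_pfilter Bn0.
have PF : Filter (powerset_filter_from (set_nbhs B)).
  exact: powerset_filter_from_filter.
have NA := (compact_near_coveringP A).1 cA.
have [x Ax|S [SB _ [W SW]] cover] :=
    NA _ _ (fun W x => ~ closure W x) PF.
  have nBx : nbhs x (~` B).
    apply: open_nbhs_nbhs; split; first exact: closed_openC.
    by move=> Bx; have : (A `&` B) x by []; rewrite AB0.
  have [V] := lcT x I; rewrite withinET => Vx [cV _].
  have [M xM MB] := compact_regular hT cV Vx nBx.
  exists (M°, [set W | W `<=` ~` closure M]).
    split; first exact: nbhs_interior.
    apply/near_powerset_filter_fromP; first by move=> ? ?; exact: subset_trans.
    exists (~` closure M) => //.
    apply/set_nbhsP; exists (~` closure M); split => //.
      exact/closed_openC/closed_closure.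
    by move=> b Bb /MB.
  move=> [y W] [/= My WM] clWy.
  have [z [Wz Mz]] := clWy _ My.
  by have := WM _ Wz; apply; apply: subset_closure.
have nW := cover W SW; have BW := SB W SW.
exists (~` closure W); split=> //.
  exact/closed_openC/closed_closure.
rewrite -subset0 => b [clb Bb].
have [z [nWz Wz]] := clb _ (BW b Bb).
by apply: nWz; exact: subset_closure.
Qed.

(** In a compact set [K], the intersection of the relatively clopen subsets
    containing [x] is connected: a clopen splitting of this intersection
    extends, by separation and compactness, to a clopen splitting of some
    member of the family. *)
Lemma quasi_component_connected (T : topologicalType) (K : set T) (x : T) :
  hausdorff_space T -> locally_compact [set: T] -> compact K -> K x ->
  connected (\bigcap_(C in [set C | [/\ C `<=` K, closed C, closed (K `\` C)
                                     & C x]]) C).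
Proof.
move=> hT lcT cK Kx; set D := [set C | _]; set Q := \bigcap_(C in D) C.
have clK := compact_closed hT cK.
have DK : D K.
  by split=> //; rewrite setDv; exact: closed0.
have clQ : closed Q by apply: closed_bigI => C [].
have QK : Q `<=` K by move=> y /(_ _ DK).
have cQ : compact Q by exact: subclosed_compact cK QK.
move=> B [b Bb] [C1 oC1 BC1] [C2 clC2 BC2].
have clB : closed B by rewrite BC2; exact: closedI.
have cB : compact B by apply: subclosed_compact cQ _ => //; rewrite BC2 => ? [].
have clQB : closed (Q `\` B).
  have -> : Q `\` B = Q `&` ~` C1.
    by rewrite BC1 setDE setCI setIUr setICr set0U.
  by apply: closedI => //; exact: open_closedC.
have [|O [oO BO OQB]] := hausdorff_compact_separation hT lcT cB clQB.
  by rewrite setDE setICA setICr setI0.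
have [|||||C DC CO] := @compact_bigcap_sub T _ D id K (O `|` ~` closure O) cK.
- by apply: openU => //; exact/closed_openC/closed_closure.
- by move=> C [].
- by exists K.
- move=> C C' [CK clC clKC Cx] [C'K clC' clKC' C'x]; exists (C `&` C') => //.
  split; [by move=> y [/CK]|exact: closedI| |by []].
  by rewrite setDIr; exact: closedU.
- move=> y [_ Qy]; have [By|nBy] := pselect (B y); first by left; exact: BO.
  by right=> clOy; have : (closure O `&` (Q `\` B)) y by []; rewrite OQB.
have [CK clC clKC Cx] := DC.
have clCO : closed (C `&` O).
  have -> : C `&` O = C `&` closure O.
    apply/seteqP; split=> y [Cy Oy]; split=> //; first exact: subset_closure.
    by case: (CO y (conj (CK y Cy) Cy)).
  by apply: closedI => //; exact: closed_closure.
have clCnO : closed (C `\` O).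
  by rewrite setDE; apply: closedI => //; exact: open_closedC.
have CE : C = (C `&` O) `|` (C `\` O) by rewrite setUIDK.
(* Of the two clopen pieces [C `&` O] and [C `\` O] of [C], the one that
   contains [x] contains all of [Q]. *)
have [Ox|nOx] := pselect (O x).
  have DCO : D (C `&` O).
    split=> //; first by move=> y [/CK].
    have -> : K `\` (C `&` O) = (K `\` C) `|` (C `\` O).
      apply/seteqP; split=> [y [Ky nCO]|y [[Ky nCy]|[Cy nOy]]].
      - have [Cy|nCy] := pselect (C y); last by left.
        by right; split=> // Oy; apply: nCO.
      - by split=> // -[].
      - by split; [exact: CK|case].
    exact: closedU.
  apply/seteqP; split=> y; first by rewrite BC1 => -[].
  move=> Qy; apply: contrapT => nBy.
  have [_ Oy] := Qy _ DCO.
  have : (closure O `&` (Q `\` B)) y by split=> //; exact: subset_closure.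
  by rewrite OQB.
have DCO : D (C `\` O).
  split=> //; first by move=> y [/CK].
  have -> : K `\` (C `\` O) = (K `\` C) `|` (C `&` O).
    apply/seteqP; split=> [y [Ky nCO]|y [[Ky nCy]|[Cy Oy]]].
    - have [Cy|nCy] := pselect (C y); last by left.
      by right; split=> //; apply: contrapT => nOy; apply: nCO.
    - by split=> // -[].
    - by split; [exact: CK|case].
  exact: closedU.
have Qb : Q b by move: Bb; rewrite BC1 => -[].
by have [_] := Qb _ DCO; case; exact: BO.
Qed.

Lemma totally_disconnected_compact_open (T : topologicalType) (x : T)
    (N : set T) :
  hausdorff_space T -> locally_compact [set: T] ->
  totally_disconnected [set: T] -> nbhs x N ->
  exists C, [/\ compact C, open C, C x & C `<=` N].
Proof.
move=> hT lcT tdT xN.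
have [K] := lcT x I; rewrite withinET => xK [cK clK].
have Kx := nbhs_singleton xK.
have conQ := quasi_component_connected hT lcT cK Kx.
set D := [set C | _] in conQ; set Q := \bigcap_(C in D) C in conQ.
have DK : D K by split=> //; rewrite setDv; exact: closed0.
have Qx : Q x by move=> C [].
have QE : Q `<=` [set x].
  by rewrite -(tdT x I) => y Qy; exists Q.
have [|||||C [CK clC clKC Cx] CO] :=
    @compact_bigcap_sub T _ D id K (N° `&` K°) cK.
- by apply: openI; exact: open_interior.
- by move=> C [].
- by exists K.
- move=> C C' [CK clC clKC Cx] [C'K clC' clKC' C'x]; exists (C `&` C') => //.
  split; [by move=> y [/CK]|exact: closedI| |by []].
  by rewrite setDIr; exact: closedU.
- by move=> y [_ /QE ->]; split; exact: nbhs_singleton (nbhs_interior _).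
exists C; split=> //.
- exact: subclosed_compact cK CK.
- (* [C] is open in the ambient space as it lies in the interior of [K]. *)
  have -> : C = (N° `&` K°) `&` ~` (K `\` C).
    apply/seteqP; split=> y.
      by move=> Cy; split; [exact: (CO _ (conj (CK _ Cy) Cy))|case].
    move=> [[_ /interior_subset Ky]] h; apply: contrapT => nCy; exact: h.
  by apply: openI; [apply: openI; exact: open_interior|exact: closed_openC].
- by move=> y Cy; have [/interior_subset] := CO _ (conj (CK _ Cy) Cy).
Qed.

(** * Totally disconnected locally compact groups *)

Section TopologicalGroups.
Local Open Scope group_scope.
Context {G : topologicalGroupType}.
Implicit Types (g h x y : G) (K N V W : set G).

Lemma mulg_cvg (T : Type) (F : set_system T) (FF : Filter F) (f h : T -> G)
    (x y : G) :
  f @ F --> x -> h @ F --> y -> (fun t => f t * h t) @ F --> x * y.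
Proof.
move=> fx hy; apply: (@cvg_comp _ _ _ (fun t => (f t, h t))
  (fun p : G * G => p.1 * p.2)); first exact: cvg_pair fx hy.
exact: (@mulg_continuous G (x, y)).
Qed.

Lemma continuous_mulg (T : topologicalType) (f h : T -> G) :
  continuous f -> continuous h -> continuous (fun t => f t * h t).
Proof. by move=> cf ch t; apply: mulg_cvg; [exact: cf|exact: ch]. Qed.

Lemma continuous_invg (T : topologicalType) (f : T -> G) :
  continuous f -> continuous (fun t => (f t)^-1).
Proof.
move=> cf t; apply: (continuous_comp (cf t)).
exact: (@invg_continuous G (f t)).
Qed.

Lemma continuous_mulgl h : continuous (fun x : G => h * x).
Proof. by apply: continuous_mulg => // x; [exact: cvg_cst|exact: cvg_id]. Qed.

Lemma continuous_mulgr h : continuous (fun x : G => x * h).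
Proof. by apply: continuous_mulg => // x; [exact: cvg_id|exact: cvg_cst]. Qed.

Lemma continuous_conjg h : continuous (fun x : G => x ^ h).
Proof.
move=> x.
apply: (@continuous_comp _ _ _ (fun x : G => x * h) (fun x => h^-1 * x)).
  exact: continuous_mulgr.
exact: continuous_mulgl.
Qed.

Lemma totally_disconnected_group_hausdorff :
  totally_disconnected [set: G] -> hausdorff_space G.
Proof.
move=> tdG.
have cl1 : closed [set 1 : G].
  by rewrite -(tdG 1 I); exact: component_closed.
move=> p q pq; apply: contrapT => npq.
have co : continuous (fun z : G * G => z.1^-1 * z.2).
  apply: continuous_mulg; first apply: continuous_invg.
    by move=> z; exact: cvg_fst.
  by move=> z; exact: cvg_snd.
have : nbhs ((fun z : G * G => z.1^-1 * z.2) (p, q)) (~` [set 1]).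
  apply: open_nbhs_nbhs; split; first exact: closed_openC.
  move=> /= e; apply: npq; apply: esym.
  by rewrite -[q]mul1g -(mulgV p) -mulgA e mulg1.
move=> /co [[A B] [/= pA qB] AB].
have [z [Az Bz]] := pq _ _ pA qB.
by have /= := AB (z, z) (conj Az Bz); rewrite mulVg; apply.
Qed.

(** Subgroups, as subsets of the type [G]. *)
Definition is_subgroup V := V 1 /\ forall x y, V x -> V y -> V (x * y^-1).

Lemma is_subgroupV V x : is_subgroup V -> V x -> V x^-1.
Proof. by move=> [V1 VM] Vx; rewrite -div1g; exact: VM. Qed.

Lemma is_subgroupM V x y : is_subgroup V -> V x -> V y -> V (x * y).
Proof.
move=> sV Vx Vy; rewrite -[y]invgK; apply: sV.2 => //; exact: is_subgroupV.
Qed.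

Lemma open_subgroup V : is_subgroup V -> nbhs 1 V -> open V.
Proof.
move=> sV nV; rewrite openE => x Vx; rewrite /interior /=.
have : nbhs (x^-1 * x) V by rewrite mulVg.
move=> /(@continuous_mulgl x^-1 x) nx.
apply: (filterS (F := nbhs (x : G)) _ nx) => y /= Vy.
by rewrite -(mulVKg x y); exact: is_subgroupM.
Qed.

Lemma open_subgroup_closed V : is_subgroup V -> open V -> closed V.
Proof.
move=> sV oV x clx.
have : nbhs (x^-1 * x) V.
  by rewrite mulVg; apply: open_nbhs_nbhs; split=> //; exact: sV.1.
move=> /(@continuous_mulgl x^-1 x) /clx [y [Vy /= Vxy]].
rewrite -[x]invgK; apply: is_subgroupV => //.
by rewrite -(mulgK y x^-1); exact: sV.2.
Qed.

(** Van Dantzig's theorem: the compact open subgroups form a basis of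
    neighbourhoods of [1]. The subgroup [V] below is the stabilizer, under right
    translations, of a compact open neighbourhood [K] of [1] contained in [N];
    it is open because [K] is compact and open. *)
Lemma van_dantzig N :
  totally_disconnected [set: G] -> locally_compact [set: G] -> nbhs 1 N ->
  exists V, [/\ is_subgroup V, compact V, open V & V `<=` N].
Proof.
move=> tdG lcG nN.
have hG := totally_disconnected_group_hausdorff tdG.
have [K [cK oK K1 KN]] := totally_disconnected_compact_open hG lcG tdG nN.
pose S := [set h | forall x, K x -> K (x * h)].
have S1 : nbhs 1 S.
  have NK := (compact_near_coveringP K).1 cK.
  have := NK _ (nbhs (1 : G)) (fun h x => K (x * h)) _.
  apply => x Kx.
  have : nbhs (x * 1) K by rewrite mulg1; exact: open_nbhs_nbhs.
  by move/(@mulg_continuous G (x, 1)).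
pose V := [set h | S h /\ S h^-1].
have SM h k : S h -> S k -> S (h * k).
  by move=> Sh Sk x Kx; rewrite mulgA; exact/Sk/Sh.
have sV : is_subgroup V.
  have S_1 : S 1 by move=> x; rewrite mulg1.
  split; first by split; rewrite ?invg1.
  by move=> x y [Sx Sx'] [Sy Sy']; split; [|rewrite invgF]; exact: SM.
have VK : V `<=` K by move=> h [Sh _]; rewrite -[h]mul1g; exact: Sh.
have oV : open V.
  apply: open_subgroup => //; apply: filterI => //.
  have : nbhs (1 : G)^-1 S by rewrite invg1.
  exact: (@invg_continuous G 1).
exists V; split=> //; last exact: subset_trans KN.
by apply: subclosed_compact cK VK; exact: open_subgroup_closed.
Qed.

Lemma open_forall_lt (T : topologicalType) (A : nat -> set T) n :
  (forall i, open (A i)) -> open [set x | forall i, (i < n)%N -> A i x].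
Proof.
move=> oA; elim: n => [|n IHn].
  by rewrite (_ : mkset _ = setT); [exact: openT|apply/seteqP; split].
rewrite (_ : mkset _ = [set x | forall i, (i < n)%N -> A i x] `&` A n).
  exact: openI.
apply/seteqP; split=> x /=.
  by move=> Ax; split=> [i i_n|]; apply: Ax => //; exact: ltnW.
by move=> [Ax Anx] i; rewrite ltnS leq_eqVlt => /predU1P[->|/Ax].
Qed.

Lemma open_conjg V h : open V -> open [set x | V (x ^ h)].
Proof. by move=> oV; apply: open_comp oV => x _; exact: continuous_conjg. Qed.

Lemma closed_conjg V h : closed V -> closed [set x | V (x ^ h)].
Proof. by move=> cV; apply: closed_comp cV => x _; exact: continuous_conjg. Qed.

Lemma compact_conjg V h : compact V -> compact [set x | V (x ^ h)].
Proof.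
move=> cV; rewrite (_ : mkset _ = (fun x => x ^ h^-1) @` V).
  apply: continuous_compact cV; apply: continuous_subspaceT => x.
  exact: continuous_conjg.
apply/seteqP; split=> [x Vx|_ [x Vx <-]] /=; last by rewrite conjgKV.
by exists (x ^ h) => //; rewrite conjgK.
Qed.

Lemma open_mulr (A V : set G) : open V -> open [set a * v | a in A & v in V].
Proof.
move=> oV; rewrite (_ : image2 _ _ _ = \bigcup_(a in A) [set x | V (a^-1 * x)]).
  apply: bigcup_open => a _; apply: open_comp oV => x _.
  exact: continuous_mulgl.
apply/seteqP; split=> [_ [a Aa [v Vv <-]]|x [a Aa /= Vx]].
  by exists a => //=; rewrite mulKg.
by exists a => //; exists (a^-1 * x) => //; rewrite mulVKg.
Qed.

(** * Willis's factorization of a compact open subgroup *)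

Section Tidy.
Variables (g : G) (V : set G).
Hypotheses (sV : is_subgroup V) (cV : compact V) (oV : open V).

Let clV : closed V := open_subgroup_closed sV oV.

(** The elements whose forward orbit under conjugation by [g] stays in [V]. *)
Let Vp := [set x | forall n, V (x ^ g ^+ n)].
(** The elements whose first [m + 1] conjugates by powers of [g] lie in [V]. *)
Let W (m : nat) := [set x | forall i, (i < m.+1)%N -> V (x ^ g ^+ i)].

Let conjgXS x n : (x ^ g) ^ g ^+ n = x ^ g ^+ n.+1.
Proof. by rewrite -conjgM expgS. Qed.

Let sVp : is_subgroup Vp.
Proof.
split=> [n|x y Vx Vy n]; first by rewrite conj1g; exact: sV.1.
by rewrite conjMg conjVg; exact: sV.2.
Qed.

Let sW m : is_subgroup (W m).
Proof.
split=> [n _|x y Vx Vy n nm]; first by rewrite conj1g; exact: sV.1.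
by rewrite conjMg conjVg; apply: sV.2; [exact: Vx|exact: Vy].
Qed.

Let VpW m : Vp `<=` W m.
Proof. by move=> x Vx i _; exact: Vx. Qed.

(** For some [m], every element of [W m] is, up to a left factor in [Vp], an
    element of [W m] that remains in [W m] after conjugation by [g^-1]. Indeed
    the set of the [x] with all [x ^ g^i], [i >= 1], in [V] is the intersection
    of the compact sets obtained by bounding [i], so one of these lies in the
    product of this set with the open set [V]. *)
Lemma tidy_step : exists m, forall w, W m w ->
  exists p u, [/\ Vp p, W m u, w = p * u & W m (u ^ g^-1)].
Proof.
pose K := [set x | V (x ^ g)].
have cK : compact K by exact: compact_conjg.
pose A := [set x | Vp (x ^ g)].
pose C n := [set x | forall i, (i < n)%N -> V (x ^ g ^+ i.+1)].
have [||||m _ Km] := @compact_bigcap_sub _ _ setT C K _ cK (open_mulr A oV).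
- by move=> n _; apply: closed_bigI => i _; exact: closed_conjg.
- by exists 0%N.
- move=> i j _ _; exists (maxn i j) => // x Cx; split=> k kn; apply: Cx.
    by rewrite (leq_trans kn)// leq_maxl.
  by rewrite (leq_trans kn)// leq_maxr.
- move=> x [Kx Cx]; exists x.
    by move=> n; rewrite conjgXS; apply: (Cx n.+1).
  by exists 1; [exact: sV.1|rewrite mulg1].
exists m => w Ww.
have [|a Aa [b Vb ab]] := Km (w ^ g^-1).
  split; first by have := Ww 0%N isT; rewrite /K /= conjgKV expg0 conjg1.
  by move=> i im; rewrite -conjgXS conjgKV; apply: Ww; exact: ltnW.
have wE : w = a ^ g * b ^ g by rewrite -conjMg ab conjgKV.
have Wb : W m (b ^ g).
  rewrite -(mulKg (a ^ g) (b ^ g)) -wE; apply: (is_subgroupM (sW m)) => //.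
  by apply: (is_subgroupV (sW m)); exact: VpW.
exists (a ^ g), (b ^ g); split=> //.
rewrite conjgK => -[_|i im]; first by rewrite expg0 conjg1.
by rewrite -conjgXS; apply: Wb; exact: ltnW.
Qed.

(** Iterating the factorization of [tidy_step] [n] times. *)
Lemma tidy_iter m :
  (forall w, W m w ->
    exists p u, [/\ Vp p, W m u, w = p * u & W m (u ^ g^-1)]) ->
  forall n w, W m w -> exists p u, [/\ Vp p, w = p * u &
    forall i, (i < n)%N -> W m (u ^ g ^- i)].
Proof.
move=> step; elim=> [|n IHn] w Ww.
  by exists 1, w; split=> //; [exact: sVp.1|rewrite mul1g].
have [p [u [Vpp Wu wE Wu']]] := step w Ww.
have [p' [u' [Vpp' uE Wn]]] := IHn _ Wu'.
have Vpg : Vp (p' ^ g) by move=> k; rewrite conjgXS.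
have uE' : u = p' ^ g * u' ^ g by rewrite -conjMg -uE conjgKV.
exists (p * p' ^ g), (u' ^ g); split.
- exact: (is_subgroupM sVp).
- by rewrite -mulgA -uE'.
- case=> [_|i i_n].
    rewrite expg0 invg1 conjg1 -(mulKg (p' ^ g) (u' ^ g)) -uE'.
    apply: (is_subgroupM (sW m)) => //.
    by apply: (is_subgroupV (sW m)); exact: VpW.
  by rewrite expgSr invgM -conjgM mulVKg; exact: Wn.
Qed.

(** Compactness of [Vp] lets [n] tend to infinity in [tidy_iter]. *)
Lemma tidy_above_subgroup : nbhs 1 [set p * u | p in Vp &
  u in [set u | forall n, V (u ^ g ^- n)]].
Proof.
have [m step] := tidy_step.
have cVp : compact Vp.
  apply: (subclosed_compact _ cV) => [|x /(_ 0%N)];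
    last by rewrite expg0 conjg1.
  have -> : Vp = \bigcap_n [set x | V (x ^ g ^+ n)].
    by apply/seteqP; split=> x Vx n => [_|]; exact: Vx.
  by apply: closed_bigI => i _; exact: closed_conjg.
have oW : open (W m) by apply: open_forall_lt => i; exact: open_conjg.
have clW : closed (W m) by exact: open_subgroup_closed (sW m) oW.
have WV x : W m x -> V x by move=> /(_ 0%N isT); rewrite expg0 conjg1.
suff WE w : W m w -> exists2 p, Vp p & forall i, W m ((p^-1 * w) ^ g ^- i).
  apply: (@filterS _ (nbhs (1 : G)) _ (W m)).
    move=> w /WE[p Vpp Ww]; exists p => //; exists (p^-1 * w).
      by move=> n; exact: WV.
    by rewrite mulVKg.
  by apply: open_nbhs_nbhs; split=> //; exact: (sW m).1.
move=> Ww; apply: contrapT => nex.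
pose C n := [set p | forall i, (i < n)%N -> W m ((p^-1 * w) ^ g ^- i)].
have [|||||n _ Vn0] := @compact_bigcap_sub _ _ setT C Vp set0 cVp.
- exact: open0.
- move=> n _; apply: closed_bigI => i _; apply: closed_comp clW => x _.
  apply: (@continuous_comp _ _ _ (fun p => p^-1 * w) (fun y => y ^ g ^- i));
    last exact: continuous_conjg.
  apply: continuous_mulg; last by move=> y; exact: cvg_cst.
  by apply: continuous_invg => y; exact: cvg_id.
- by exists 0%N.
- move=> i j _ _; exists (maxn i j) => // x Cx; split=> k kn; apply: Cx.
    by rewrite (leq_trans kn)// leq_maxl.
  by rewrite (leq_trans kn)// leq_maxr.
- by move=> p [Vpp Cp]; apply: nex; exists p => // i; exact: (Cp i.+1 I i).
have [p [u [Vpp wE Wu]]] := tidy_iter step n Ww.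
by apply: (Vn0 p); split=> // i i_n; rewrite wE mulKg; exact: Wu.
Qed.

End Tidy.

(** For every neighbourhood [N] of [1], the elements whose forward orbit under
    conjugation by [g] stays in [N], multiplied by those whose backward orbit
    does, form a neighbourhood of [1]. *)
Lemma tidy_above g N :
  totally_disconnected [set: G] -> locally_compact [set: G] -> nbhs 1 N ->
  nbhs 1 [set p * u | p in [set p | forall n, N (p ^ g ^+ n)]
                    & u in [set u | forall n, N (u ^ g ^- n)]].
Proof.
move=> tdG lcG nN; have [V [sV cV oV VN]] := van_dantzig tdG lcG nN.
apply: filterS (tidy_above_subgroup g sV cV oV).
move=> _ [p Vp [u Vu <-]]; exists p; first by move=> n; exact/VN/Vp.
by exists u => // n; exact/VN/Vu.
Qed.

End TopologicalGroups.

(** * Geodesics in CAT(0) and hyperbolic spaces *)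

Section Plane.
Local Open Scope ring_scope.
Context {R : realType}.

Lemma plane_dist_ray (e f a b : R) : e ^+ 2 + f ^+ 2 = 1 ->
  plane_dist (a * e, a * f) (b * e, b * f) = `|a - b|.
Proof.
move=> ef; rewrite /plane_dist /= -sqrtr_sqr; congr Num.sqrt.
rewrite -[RHS]mulr1 -ef; ring.
Qed.

(** A Euclidean triangle with apex at the origin and sides [L], [L'] and [D],
    the side [L] being along the first axis and [(e, f)] the direction of the side
    [L']; the points at distance [t] from the apex on these two sides are at
    distance at most [D] from each other. *)
Lemma plane_triangle (L L' D : R) :
  0 < L -> 0 < L' -> `|L - L'| <= D -> D <= L + L' ->
  exists e f : R, [/\ e ^+ 2 + f ^+ 2 = 1,
    plane_dist (L' * e, L' * f) (L * 1, L * 0) = D &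
    forall t, 0 <= t -> t <= L -> t <= L' ->
      plane_dist (t * 1, t * 0) (t * e, t * f) <= D].
Proof.
move=> L0 L'0 DL DLL.
have D0 : 0 <= D by exact: le_trans (normr_ge0 _) DL.
(* The law of cosines. *)
pose e := (L ^+ 2 + L' ^+ 2 - D ^+ 2) / (2 * L * L').
have LL0 : 0 < 2 * L * L' by rewrite !mulr_gt0.
have eE : 2 * L * L' * e = L ^+ 2 + L' ^+ 2 - D ^+ 2.
  by rewrite /e mulrC divfK// gt_eqF.
have D1 : (L - L') ^+ 2 <= D ^+ 2.
  by rewrite -[X in X <= _]real_normK ?num_real// lerXn2r ?nnegrE.
have D2 : D ^+ 2 <= (L + L') ^+ 2.
  by rewrite lerXn2r ?nnegrE// addr_ge0// ltW.
have e1 : e <= 1 by rewrite /e ler_pdivrMr// mul1r; nra.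
have e_1 : -1 <= e by rewrite /e ler_pdivlMr//; nra.
have e2 : 0 <= 1 - e ^+ 2 by nra.
pose f := Num.sqrt (1 - e ^+ 2).
have fE : f ^+ 2 = 1 - e ^+ 2 by rewrite sqr_sqrtr.
exists e, f; split; first by rewrite fE; ring.
  rewrite /plane_dist /= -[RHS]ger0_norm// -sqrtr_sqr; congr Num.sqrt.
  have -> : (L' * e - L * 1) ^+ 2 + (L' * f - L * 0) ^+ 2 =
    L' ^+ 2 * (e ^+ 2 + f ^+ 2) + L ^+ 2 - 2 * L * L' * e by ring.
  by rewrite fE eE; ring.
move=> t t0 tL tL'; rewrite /plane_dist /= -[leRHS]ger0_norm// -sqrtr_sqr.
apply: ler_wsqrtr.
have -> : (t * 1 - t * e) ^+ 2 + (t * 0 - t * f) ^+ 2 =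
  2 * t ^+ 2 * (1 - e).
  have -> : (t * 1 - t * e) ^+ 2 + (t * 0 - t * f) ^+ 2 =
   t ^+ 2 * (1 - 2 * e + e ^+ 2 + f ^+ 2) by ring.
  by rewrite fE; ring.
have -> : D ^+ 2 = L ^+ 2 + L' ^+ 2 - 2 * L * L' * e by rewrite eE; ring.
have tt : t ^+ 2 <= L * L' by rewrite expr2; apply: ler_pM.
have : t ^+ 2 * (1 - e) <= L * L' * (1 - e).
  by apply: ler_wpM2r => //; rewrite subr_ge0.
have := sqr_ge0 (L - L').
move: tt; nra.
Qed.

End Plane.

Section Segments.
Local Open Scope ring_scope.
Context {R : realType} {X : metricType R}.
Implicit Types (p q x y : X) (s c : R -> X).

Lemma itvcc0P (l t : R) : `[0, l]%classic t <-> 0 <= t <= l.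
Proof. by rewrite /= in_itv /=. Qed.

Lemma segment_pointsP x y s z :
  segment_points x y s z <-> exists2 t, 0 <= t <= mdist x y & s t = z.
Proof. by split=> -[t /itvcc0P tL stz]; exists t => //; exact/itvcc0P. Qed.

Lemma mdist_sub_le p q x : `|mdist p x - mdist q x| <= mdist p q.
Proof.
have := metric_triangle p q x; have := metric_triangle q p x.
by rewrite (metric_sym q p) ler_norml => ? ?; lra.
Qed.

Lemma segment_dist x y s t t' : geodesic_segment x y s ->
  0 <= t <= mdist x y -> 0 <= t' <= mdist x y -> mdist (s t) (s t') = `|t - t'|.
Proof. by move=> [iso _ _] h h'; apply: iso; apply/itvcc0P. Qed.

Lemma segment_distl x y s t : geodesic_segment x y s ->
  0 <= t <= mdist x y -> mdist x (s t) = t.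
Proof.
move=> sg tL; case: (sg) => _ s0 _; rewrite -[in LHS]s0 (segment_dist sg)//.
  by rewrite sub0r normrN ger0_norm//; case/andP: tL.
by rewrite lexx mdist_ge0.
Qed.

Lemma segment_distr x y s t : geodesic_segment x y s ->
  0 <= t <= mdist x y -> mdist (s t) y = mdist x y - t.
Proof.
move=> sg tL; case: (sg) => _ _ sL; rewrite -[in LHS]sL (segment_dist sg)//.
  by rewrite distrC ger0_norm// subr_ge0; case/andP: tL.
by rewrite lexx mdist_ge0.
Qed.

Lemma segment_rev x y s : geodesic_segment x y s ->
  geodesic_segment y x (fun t => s (mdist x y - t)).
Proof.
move=> [iso s0 sL]; split; rewrite ?subr0// (metric_sym y x) ?subrr//.
move=> t t' /itvcc0P/andP[t0 tL] /itvcc0P/andP[t'0 t'L].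
rewrite iso; first by rewrite opprB addrC addrA subrK distrC.
all: by apply/itvcc0P; apply/andP; split; lra.
Qed.

Lemma ray_segment c t : geodesic_ray c -> 0 <= t ->
  geodesic_segment (c 0) (c t) c.
Proof.
move=> rc t0.
have cE : mdist (c 0) (c t) = t.
  by rewrite rc /= ?in_itv/= ?lexx ?t0// sub0r normrN ger0_norm.
split; rewrite ?cE// => u v /itvcc0P/andP[u0 _] /itvcc0P/andP[v0 _].
by rewrite rc//= in_itv/= andbT.
Qed.

(** The Gromov product bounds from below the distance to a geodesic. *)
Lemma gromov_product_le p x y s w : geodesic_segment x y s ->
  0 <= w <= mdist x y -> gromov_product p x y <= mdist p (s w).
Proof.
move=> sg wL; rewrite /gromov_product ler_pdivrMr//.
have := metric_triangle p (s w) x; have := metric_triangle p (s w) y.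
rewrite (metric_sym (s w) x) (segment_distl sg wL) (segment_distr sg wL); lra.
Qed.

Lemma gromov_product_le_mdist p x y : gromov_product p x y <= mdist p x.
Proof.
rewrite /gromov_product ler_pdivrMr//.
by have := metric_triangle p x y; lra.
Qed.

(** The comparison is made between points at the same distance [t] from the
    common endpoint [x]; passing from there to points at the same distance from
    [p] and [q] costs at most [mdist p q] more. *)
Lemma CAT0_fellow_travel p q x s s' r : geodesic_space X -> is_CAT0 (X := X) ->
  geodesic_segment p x s -> geodesic_segment q x s' ->
  0 <= r -> r <= mdist p x -> r <= mdist q x ->
  mdist (s r) (s' r) <= 3 * mdist p q.
Proof.
move=> geoX cat sg sg' r0 rL rL'.
set L := mdist p x in rL *; set L' := mdist q x in rL' *.
set D := mdist p q.
have D0 : 0 <= D by exact: mdist_ge0.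
have DL : `|L - L'| <= D by exact: mdist_sub_le.
have DLL : D <= L + L'.
  by rewrite /D /L' (metric_sym q x); exact: metric_triangle.
have rL_ : 0 <= r <= L by rewrite r0.
have rL'_ : 0 <= r <= L' by rewrite r0.
(* For [r <= D] the triangle inequality is enough; otherwise [t] below is at
   most [L']. *)
have [rD|Dr] := lerP r D.
  have := metric_triangle (s r) p (s' r); have := metric_triangle p q (s' r).
  rewrite (metric_sym (s r) p) (segment_distl sg)// (segment_distl sg')//.
  by rewrite -/D; lra.
have L0 : 0 < L by lra.
have L'0 : 0 < L' by lra.
have [e [f [ef pD small]]] := plane_triangle L0 L'0 DL DLL.
have [s3 sg3] := geoX q p.
have ef1 : (1 : R) ^+ 2 + 0 ^+ 2 = 1 by rewrite expr1n expr0n addr0.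
have h0 (u v : R) : ((0 : R), (0 : R)) = (0 * u, 0 * v) by rewrite !mul0r.
move: DL; rewrite ler_norml => /andP[DL1 DL2].
pose t := L - r.
have t0 : 0 <= t by rewrite /t; lra.
have tL : t <= L by rewrite /t; lra.
have tL' : t <= L' by rewrite /t; lra.
have tri : geodesic_triangle p x q s (fun t => s' (mdist q x - t)) s3.
  by split=> //; exact: segment_rev.
have px : plane_dist (L * 1, L * 0) (0, 0) = mdist p x.
  by rewrite (h0 1 0) plane_dist_ray// subr0 ger0_norm// ltW.
have xq : plane_dist (0, 0) (L' * e, L' * f) = mdist x q.
  rewrite (h0 e f) plane_dist_ray// sub0r normrN ger0_norm; last exact: ltW.
  by rewrite metric_sym.
have qp : plane_dist (L' * e, L' * f) (L * 1, L * 0) = mdist q p.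
  by rewrite pD /D metric_sym.
have : mdist (s r) (s' (L' - t)) <= plane_dist (t * 1, t * 0) (t * e, t * f).
  apply: (cat _ _ _ _ _ _ _ _ _ tri px xq qp).
    apply: Or31; exists r; split=> //.
    by rewrite plane_dist_ray// ger0_norm /t; lra.
    by rewrite (h0 1 0) plane_dist_ray// subr0 ger0_norm.
  apply: Or32; exists t; split=> //.
  - by apply/itvcc0P; rewrite metric_sym t0.
  - by rewrite (h0 e f) plane_dist_ray// sub0r normrN ger0_norm.
  - by rewrite plane_dist_ray// distrC ger0_norm /L' ?(metric_sym x)// subr_ge0.
have := small t t0 tL tL'.
have : mdist (s' (L' - t)) (s' r) <= D.
  rewrite (segment_dist sg')//; last by apply/andP; split; rewrite -/L'; lra.
  by rewrite /t ler_norml; apply/andP; split; lra.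
have := metric_triangle (s r) (s' (L' - t)) (s' r).
lra.
Qed.

Lemma thin_fellow_travel (delta : R) p q x s s' r :
  geodesic_space X -> 0 <= delta -> thin_triangles (X := X) delta ->
  geodesic_segment p x s -> geodesic_segment q x s' ->
  0 <= r -> r <= mdist p x -> r <= mdist q x ->
  mdist (s r) (s' r) <= 3 * mdist p q + 2 * delta.
Proof.
move=> geoX d0 thin sg sg' r0 rL rL'.
have [s3 sg3] := geoX q p.
have D0 : 0 <= mdist p q by exact: mdist_ge0.
have rL_ : 0 <= r <= mdist p x by rewrite r0.
have rL'_ : 0 <= r <= mdist q x by rewrite r0.
have tri : geodesic_triangle p x q s (fun t => s' (mdist q x - t)) s3.
  by split=> //; exact: segment_rev.
have [near1 _ _] := thin _ _ _ _ _ _ tri.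
have [|z sz dz] := near1 (s r); first by apply/segment_pointsP; exists r.
have spr := segment_distl sg rL_; have s'qr := segment_distl sg' rL'_.
case: sz => /segment_pointsP[t tL zE].
  have wL : 0 <= mdist q x - t <= mdist q x.
    move: tL; rewrite (metric_sym q x) => /andP[? ?].
    by apply/andP; split; lra.
  have sqw := segment_distl sg' wL; have := segment_dist sg' wL rL'_.
  set w := mdist q x - t in wL sqw zE *; rewrite zE in sqw *.
  have := metric_triangle p q z; have := metric_triangle q p z.
  have := metric_triangle p (s r) z; have := metric_triangle p z (s r).
  have := metric_triangle (s r) z (s' r).
  rewrite (metric_sym q p) (metric_sym z (s r)) spr sqw.
  move=> H1 H2 H3 H4 H5 H6.
  have : `|w - r| <= mdist p q + delta.
    by rewrite ler_norml; apply/andP; split; lra.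
  rewrite -H6; lra.
have := segment_distl sg3 tL; rewrite zE => qz.
have := metric_triangle p q (s r); have := metric_triangle (s r) q (s' r).
have := metric_triangle q z (s r).
rewrite (metric_sym z) (metric_sym (s r) q) spr s'qr qz.
by move: tL; rewrite (metric_sym q p) => /andP[? ?]; lra.
Qed.

Lemma NPC_fellow_travel k : NPC k X -> exists2 E : R, 0 <= E &
  forall p q x s s' r,
    geodesic_segment p x s -> geodesic_segment q x s' ->
    0 <= r -> r <= mdist p x -> r <= mdist q x ->
    mdist (s r) (s' r) <= 3 * mdist p q + E.
Proof.
case: k => -[geoX [_ hX]].
  exists 0 => // p q x s s' r sg sg' r0 rp rq; rewrite addr0.
  exact: (CAT0_fellow_travel geoX hX sg sg').
have [delta d0 thin] := hX.
exists (2 * delta) => [|p q x s s' r sg sg' r0 rp rq].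
  by rewrite mulr_ge0.
exact: (thin_fellow_travel geoX d0 thin sg sg').
Qed.

(** Geodesics with no endpoint in common, compared through a geodesic from
    [q] to [x]. *)
Lemma NPC_fellow_travel2 k : NPC k X -> exists2 E : R, 0 <= E &
  forall p q x y s s' r,
    geodesic_segment p x s -> geodesic_segment q y s' ->
    0 <= r -> r <= mdist p x -> r <= mdist q y -> r <= mdist q x ->
    mdist (s r) (s' r) <= 3 * mdist p q + 5 * mdist x y + E.
Proof.
move=> npc; have [E E0 fellow] := NPC_fellow_travel npc.
have [geoX _] := npc.
exists (2 * E) => [|p q x y s s' r sg sg' r0 rpx rqy rqx].
  by rewrite mulr_ge0.
have [u ug] := geoX q x.
have D1 := fellow _ _ _ _ _ _ sg ug r0 rpx rqx.
(* The geodesics from [q] to [x] and [y] are compared at distance [m - r] from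
   [x] and [y]; this shifts the times by at most [mdist x y]. *)
pose m := Num.min (mdist q x) (mdist q y).
have mx : m <= mdist q x by rewrite ge_min lexx.
have my : m <= mdist q y by rewrite ge_min lexx orbT.
have rm : r <= m by rewrite le_min rqx.
have m1 : mdist q x - m <= mdist x y.
  rewrite /m; case: (leP (mdist q x)) => _; first by rewrite subrr mdist_ge0.
  by have := metric_triangle q y x; rewrite (metric_sym y x); lra.
have m2 : mdist q y - m <= mdist x y.
  rewrite /m; case: (leP (mdist q x)) => _; last by rewrite subrr mdist_ge0.
  by have := metric_triangle q x y; lra.
have := fellow _ _ _ _ _ (m - r) (segment_rev ug) (segment_rev sg').
rewrite subr_ge0 (metric_sym x q) (metric_sym y q) => /(_ rm).
have mrx : m - r <= mdist q x by lra.
have mry : m - r <= mdist q y by lra.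
move=> /(_ mrx mry) D2.
have D3 : mdist (u r) (u (mdist q x - (m - r))) <= mdist x y.
  rewrite (segment_dist ug); [|by rewrite r0|by apply/andP; split; lra].
  by rewrite ler_norml; apply/andP; split; lra.
have D4 : mdist (s' (mdist q y - (m - r))) (s' r) <= mdist x y.
  rewrite (segment_dist sg'); [|by apply/andP; split; lra|by rewrite r0].
  by rewrite ler_norml; apply/andP; split; lra.
have := metric_triangle (s r) (u r) (s' r).
have := metric_triangle (u r) (u (mdist q x - (m - r))) (s' r).
have := metric_triangle (u (mdist q x - (m - r)))
  (s' (mdist q y - (m - r))) (s' r).
by lra.
Qed.

(** The consequence of convergence to the boundary common to the two cases: the
    geodesics from the origin of a ray to the points of the sequence eventually
    pass near each given point of the ray, with a bound independent of that
    point. In the hyperbolic case, the side of the triangle [c 0], [c t], [x n]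
    opposite to [c 0] is too far from [c 0] to be near [c r]. *)
Lemma boundary_cvg_segments k (x : nat -> X) xi c : NPC k X ->
  boundary_cvg k x xi -> rays_to xi c ->
  exists E : R, forall r, 0 < r -> \forall n \near \oo,
    r < mdist (c 0) (x n) /\
    forall s, geodesic_segment (c 0) (x n) s -> mdist (s r) (c r) <= E.
Proof.
case: k => -[geoX [_ hX]] /= xxi cxi.
  exists 1 => r r0; have := xxi c cxi r 1 r0 ltr01.
  apply: filterS => n [rn near_c]; split=> // s sg; exact/ltW/near_c.
have [delta d0 thin] := hX.
exists (2 * delta) => r r0.
have rc : geodesic_ray c.
  by have [c0 _ xiE] := rays_toP xi; move: cxi; rewrite xiE => -[].
have [[A B] /= [nA nB] AB] := xxi c cxi (c 0) (r + delta + 1).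
near=> n.
have [t [rt Bt]] : exists t, r <= t /\ B t.
  have : \forall t \near +oo, r <= t /\ B t.
    apply: filterI => //; exact: nbhs_pinfty_ge (num_real r).
  exact: filter_ex.
have An : A n by near: n.
have := AB (n, t) (conj An Bt) => /= gp.
split; first by have := gromov_product_le_mdist (c 0) (x n) (c t); lra.
move=> s sg.
have [s2 sg2] := geoX (c t) (x n).
have t0 : 0 <= t by lra.
have ct := ray_segment rc t0.
have tri : geodesic_triangle (c 0) (c t) (x n) c s2
    (fun w => s (mdist (c 0) (x n) - w)).
  by split=> //; exact: segment_rev.
have [near1 _ _] := thin _ _ _ _ _ _ tri.
have ctE : mdist (c 0) (c t) = t.
  by rewrite rc /= ?in_itv/= ?lexx ?t0// sub0r normrN ger0_norm.
have rt0 : 0 <= r <= mdist (c 0) (c t) by rewrite ctE ltW.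
have cr := segment_distl ct rt0.
have [|z sz dz] := near1 (c r); first by apply/segment_pointsP; exists r.
have := metric_triangle (c 0) (c r) z.
have rL : 0 <= r <= mdist (c 0) (x n).
  have := gromov_product_le_mdist (c 0) (x n) (c t) => ?.
  by apply/andP; split; lra.
case: sz => /segment_pointsP[w wL zE].
  have := gromov_product_le (c 0) sg2 wL; rewrite zE /gromov_product in gp *.
  by rewrite (metric_sym (c t) (x n)); move: gp; lra.
have wL' : 0 <= mdist (c 0) (x n) - w <= mdist (c 0) (x n).
  by move: wL; rewrite (metric_sym (x n)) => /andP[? ?]; apply/andP; split; lra.
have := segment_dist sg wL' rL; have := segment_distl sg wL'.
set v := _ - w in wL' zE *; rewrite zE => sv svr.
have := metric_triangle (c 0) z (c r); have := metric_triangle (s r) z (c r).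
rewrite (metric_sym (s r) z) (metric_sym z (c r)) cr sv svr => H1 H2 H3.
have : `|v - r| <= delta by rewrite ler_norml; apply/andP; split; lra.
by lra.
Unshelve. all: by end_near. Qed.

Lemma act_segment (G : groupType) (a : isometric_action G X) u x y s :
  geodesic_segment x y s -> geodesic_segment (a u x) (a u y) (a u \o s).
Proof.
move=> [iso s0 sL]; split; rewrite ?act_isometry /= ?s0 ?sL// => t t' tL t'L.
by rewrite act_isometry iso.
Qed.

Lemma boundary_eqP (xi eta : boundary X) : rays_to xi = rays_to eta -> xi = eta.
Proof.
case: xi eta => [r rP] [r' r'P] /= e; rewrite -e in r'P *.
by congr Boundary; exact: Prop_irrelevance.
Qed.

Lemma asymptotic_ray_class c c' : asymptotic c c' -> ray_class c = ray_class c'.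
Proof.
move=> [C cc']; apply/seteqP; split=> c1 [rc1 [C1 h1]]; split=> //.
  exists (C + C1) => t t0; have := metric_triangle (c' t) (c t) (c1 t).
  by rewrite (metric_sym (c' t) (c t)); have := cc' t t0; have := h1 t t0; lra.
exists (C + C1) => t t0; have := metric_triangle (c t) (c' t) (c1 t).
by have := cc' t t0; have := h1 t t0; lra.
Qed.

(** An isometry that moves the points of a sequence converging to [xi] by a
    bounded amount fixes [xi]. *)
Lemma bounded_displacement_fixes (G : groupType) (a : isometric_action G X)
    k (u : G) (x : nat -> X) xi (M : R) :
  NPC k X -> boundary_cvg k x xi -> (forall n, mdist (a u (x n)) (x n) <= M) ->
  act_boundary a u xi = xi.
Proof.
move=> npc xxi uM.
have [c rc xiE] := rays_toP xi.
have cxi : rays_to xi c.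
  by rewrite xiE; split=> //; exists 0 => t t0; rewrite mdistxx.
apply: boundary_eqP; rewrite /= xiE act_ray_class.
apply/esym/asymptotic_ray_class.
have [C conv] := boundary_cvg_segments npc xxi cxi.
have [E E0 fellow] := NPC_fellow_travel2 npc.
have [geoX _] := npc.
pose D := mdist (c 0) (a u (c 0)).
have D0 : 0 <= D by exact: mdist_ge0.
have M0 : 0 <= M by exact: le_trans (mdist_ge0 _ _) (uM 0%N).
exists (D + `|C| + `|C| + 3 * D + 5 * M + E) => t.
have C0 := normr_ge0 C.
rewrite le_eqVlt => /predU1P[<-|t0] /=; first by rewrite -/D; lra.
have tD : 0 < t + D by lra.
have [n [[_ near_t] [tn _]]] :=
  filter_ex (filterI (conv t t0) (conv (t + D) tD)).
have [s sg] := geoX (c 0) (x n).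
have st := near_t s sg.
have H1 := act_isometry a u (s t) (c t).
have lq := metric_triangle (c 0) (a u (c 0)) (x n).
have sug := act_segment a u sg.
have := fellow _ _ _ _ _ _ t sg sug.
rewrite act_isometry => /(_ (ltW t0)).
have tn1 : t <= mdist (c 0) (x n) by lra.
have tn2 : t <= mdist (a u (c 0)) (x n) by rewrite -/D in lq; lra.
move=> /(_ tn1 tn1 tn2) /= H2.
have := uM n; rewrite (metric_sym (a u (x n))) => uMn.
have := metric_triangle (c t) (s t) (a u (c t)).
have := metric_triangle (s t) (a u (s t)) (a u (c t)).
have := ler_norm C; rewrite (metric_sym (c t) (s t)) H1 -/D in H2 *.
lra.
Qed.

End Segments.

(** * Stabilizers of the attracting and repelling points *)

Section Stabilizers.
Context {R : realType} {X : metricType R} {G : topologicalGroupType}.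
Variable a : isometric_action G X.

Lemma nbhs_small_displacement (x : X) : continuous_action a ->
  nbhs (1%g : G) [set h | mdist (a h x) x <= 1]%R.
Proof.
move=> ca.
have c1 : (fun h : G => (h, x)) @ (1%g : G) --> (1%g, x).
  by apply: cvg_pair; [exact: cvg_id|exact: cvg_cst].
have := cvg_comp _ _ c1 (ca (1%g, x)).
rewrite /= act1 => /(_ _ (nbhsx_ballx _ _ ltr01)) /=.
apply: (filterS (F := nbhs (1%g : G))) => h /=.
by rewrite ballEmdist /= metric_sym => /ltW.
Qed.

(** The displacement of [h^n x] by [u] is that of [x] by [u ^ h^n]. *)
Lemma conj_bounded_fixes_attracting k (h u : G) (x : X) xi (M : R) :
  NPC k X -> attracting_point a k h xi ->
  (forall n, mdist (a (u ^ (h ^+ n))%g x) x <= M)%R ->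
  act_boundary a u xi = xi.
Proof.
move=> npc hxi uM.
apply: (bounded_displacement_fixes npc (hxi x) (M := M)) => n.
have -> : a u (a (h ^+ n)%g x) = a (h ^+ n)%g (a (u ^ (h ^+ n))%g x).
  by rewrite -!actM -conjgC.
by rewrite act_isometry.
Qed.

End Stabilizers.

Theorem corollary1p10 (k : npc_case) (R : realType) (X : metricType R)
    (G : topologicalGroupType) (a : isometric_action G X) (g : G)
    (xi_plus xi_minus : boundary X) (U : set G) :
  NPC k X ->
  totally_disconnected [set: G] ->
  locally_compact [set: G] ->
  proper_action a ->
  continuous_action a ->
  hyperbolic_isometry a k g ->
  attracting_point a k g xi_plus ->
  repelling_point a k g xi_minus ->
  open U ->
  group_closed (mem U) ->
  nbhs (1%g : G)
    [set (u * v)%g | u in boundary_stab a U xi_plus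
                   & v in boundary_stab a U xi_minus].
Proof.
move=> npc tdG lcG _ ca _ gplus gminus oU [/set_mem U1 _].
have [c _ _] := rays_toP xi_plus; pose x := c 0%R.
have nN : nbhs (1%g : G) (U `&` [set h | mdist (a h x) x <= 1]%R).
  apply: filterI; first exact: open_nbhs_nbhs.
  exact: nbhs_small_displacement.
apply: filterS (tidy_above g tdG lcG nN) => _ [p Np [u Nu <-]].
exists p.
  split; first by have [] := Np 0%N; rewrite expg0 conjg1.
  apply: (conj_bounded_fixes_attracting npc gplus (x := x)) => n.
  exact: (Np n).2.
exists u => //.
split; first by have [] := Nu 0%N; rewrite expg0 invg1 conjg1.
apply: (conj_bounded_fixes_attracting npc gminus (x := x)) => n.
by rewrite expVgn; exact: (Nu n).2.
Qed.
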